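(* Let $\mathcal H$ be a complex Hilbert space and let $T\in\mathcal B(\mathcal H)$ be weakly concave. Let $T'=T(T^*T)^{-1}$ be its Cauchy dual, and let $$\mathcal H_u:=\bigcap_{n=0}^{\infty}\mathcal R(T^n),\qquad \mathcal H'_u:=\bigcap_{n=0}^{\infty}\mathcal R(T'^n),$$ where $\mathcal R(\cdot)$ denotes the range. Then $\mathcal H'_u\subseteq\mathcal H_u$ and $\mathcal H'_u$ reduces $T$. Moreover, $T=U\oplus S$ with respect to the decomposition $\mathcal H=\mathcal H'_u\oplus(\mathcal H'_u)^{\perp}$, where $U\in\mathcal B(\mathcal H'_u)$ is unitary and $S\in\mathcal B((\mathcal H'_u)^{\perp})$ has the wandering subspace property.
   Context: $\mathcal B(\mathcal H)$ is the algebra of bounded operators on $\mathcal H$. An operator $T$ is left-invertible if $LT=I$ for some $L\in\mathcal B(\mathcal H)$ (equivalently $T^*T$ is invertible); then its Cauchy dual is $T'=T(T^*T)^{-1}$. The approximate point spectrum $\sigma_{ap}(T)$ is the set of $\lambda\in\mathbb C$ with $T-\lambda I$ not bounded below; $\mathbb D$ is the open unit disc and $\partial\mathbb D$ the unit circle. A left-invertible $T$ is weakly concave if (1) $\sigma_{ap}(T)\subseteq\partial\mathbb D$, (2) $\|x\|\le\|Tx\|$ for all $x\in\mathcal H$, and (3) $\|T'T^*x\|\le\|T'Tx\|$ for all $x\in\mathcal H$. An operator $S$ on a Hilbert space $\mathcal K$ has the wandering subspace property if $\mathcal K$ is the closed linear span of $\bigcup_{n\ge0}S^n(\ker S^* )$.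 *)

(* Defs.v *)
(* complex numbers R[i] (mathcomp-real-closed) over R : realType. *)
From HB Require Import structures.
From mathcomp Require Import all_boot all_order all_algebra.
From mathcomp Require Import complex.
From mathcomp Require Import reals.
Set Implicit Arguments. Unset Strict Implicit. Unset Printing Implicit Defensive.
Import Order.TTheory GRing.Theory Num.Theory.
Local Open Scope ring_scope.

Section Hilbert.
Variables (R : realType) (V : lmodType R[i]).
Variable ip : V -> V -> R[i].   (* inner product, linear in the first argument *)

(* the norm induced by the inner product *)
Definition hnorm (x : V) : R := Num.sqrt (complex.Re (ip x x)).

Definition cauchy_seq (u : nat -> V) : Prop :=
  forall e : R, 0 < e -> exists N, forall m n, (N <= m)%N -> (N <= n)%N ->
    hnorm (u m - u n) < e.

Definition converges_to (u : nat -> V) (l : V) : Prop :=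
  forall e : R, 0 < e -> exists N, forall n, (N <= n)%N -> hnorm (u n - l) < e.

(* (V, ip) is a complex Hilbert space *)
Definition is_hilbert : Prop :=
  [/\ (forall (a : R[i]) (x y z : V), ip (a *: x + y) z = a * ip x z + ip y z),
      (forall x y : V, ip y x = (ip x y)^*),
      (forall x : V, complex.Im (ip x x) = 0 /\ 0 <= complex.Re (ip x x)),
      (forall x : V, ip x x = 0 -> x = 0)
    & (forall u, cauchy_seq u -> exists l, converges_to u l)].

Definition is_linear (T : V -> V) : Prop :=
  forall (a : R[i]) (x y : V), T (a *: x + y) = a *: T x + T y.

(* T is an element of B(H) *)
Definition bounded_op (T : V -> V) : Prop :=
  is_linear T /\ exists M : R, forall x, hnorm (T x) <= M * hnorm x.

(* Ts is the Hilbert-space adjoint T^* of T *)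
Definition is_adjoint (T Ts : V -> V) : Prop :=
  forall x y, ip (T x) y = ip x (Ts y).

(* T is left-invertible in B(H) *)
Definition left_invertible (T : V -> V) : Prop :=
  bounded_op T /\ exists L, bounded_op L /\ forall x, L (T x) = x.

(* T - lambda I is bounded below *)
Definition bounded_below_shift (T : V -> V) (lam : R[i]) : Prop :=
  exists c : R, 0 < c /\ forall x, c * hnorm x <= hnorm (T x - lam *: x).

(* sigma_ap(T) is contained in the unit circle *)
Definition sigma_ap_in_circle (T : V -> V) : Prop :=
  forall lam : R[i], ~ bounded_below_shift T lam -> `|lam| = 1.

(* Cauchy dual T' = T (T^*T)^{-1}, given the adjoint Ts and the inverse A of T^*T *)
Definition cauchy_dual (T A : V -> V) : V -> V := fun x => T (A x).

(* T is weakly concave (Ts = T^*, A = (T^*T)^{-1}) *)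
Definition weakly_concave (T Ts A : V -> V) : Prop :=
  [/\ left_invertible T,
      sigma_ap_in_circle T,
      (forall x, hnorm x <= hnorm (T x))
    & (forall x, hnorm (cauchy_dual T A (Ts x)) <= hnorm (cauchy_dual T A (T x)))].

(* intersection of the ranges R(T^n), n >= 0 *)
Definition range_core (T : V -> V) (y : V) : Prop :=
  forall n : nat, exists x, y = iter n T x.

Definition orth (M : V -> Prop) (y : V) : Prop := forall x, M x -> ip x y = 0.

Definition closed_subspace (M : V -> Prop) : Prop :=
  [/\ M 0, (forall (a : R[i]) x y, M x -> M y -> M (a *: x + y))
    & (forall u l, (forall n, M (u n)) -> converges_to u l -> M l)].

(* M reduces T: M is a closed subspace invariant under T, and so is M^perp *)
Definition reduces (T : V -> V) (M : V -> Prop) : Prop :=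
  [/\ closed_subspace M, (forall x, M x -> M (T x))
    & (forall x, orth M x -> orth M (T x))].

(* the restriction of T to the invariant subspace M is unitary on M
   (a surjective isometry of M) *)
Definition unitary_on (T : V -> V) (M : V -> Prop) : Prop :=
  (forall x, M x -> hnorm (T x) = hnorm x) /\
  (forall y, M y -> exists2 x, M x & T x = y).

(* linear span and closed linear span of a set E *)
Definition lin_span (E : V -> Prop) (y : V) : Prop :=
  exists s : seq (R[i] * V),
    (forall p, p \in s -> E p.2) /\ y = \sum_(p <- s) p.1 *: p.2.

Definition closed_span (E : V -> Prop) (x : V) : Prop :=
  forall e : R, 0 < e -> exists2 y, lin_span E y & hnorm (x - y) < e.

(* kernel of S^*, where S is the restriction of T to the invariant subspace K
   and S^* its adjoint as an operator on K *)
Definition ker_restr_adj (T : V -> V) (K : V -> Prop) (x : V) : Prop :=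
  K x /\ forall y, K y -> ip (T y) x = 0.

(* the restriction S = T|_K has the wandering subspace property:
   K is the closed linear span of the union of S^n(ker S-adjoint) *)
Definition wandering_subspace_property (T : V -> V) (K : V -> Prop) : Prop :=
  forall x, K x <->
    closed_span (fun y => exists (n : nat) (z : V), ker_restr_adj T K z /\ y = iter n T z) x.

End Hilbert.

(* Main.v *)
(* The condition [|T' T^* x| <= |T' T x|] says that the Cauchy dual [T'] is hyponormal for the inner product
   [<A x, y>], [A = (T^* T)^-1].  On [H'_u] the contraction [T'] is invertible with inverse [T^*], so for [y] in [H'_u]
   the sequence [|T^*^n y|] is nondecreasing and log-convex: unless it is constant it grows exponentially.
   The latter is excluded because the approximate point spectrum lies on the circle, which forces
   [|T^n x| <= C r^n |x|] for every [r > 1].  This is proved without resolvents: for [s > 1] the lower bounds of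
   [T - lam], [|lam| = s], applied to partial geometric sums and averaged over the phase of [lam], give
   [sum_(n < N) (|T^n x| / s^n)^2 <= K (|x| + |T^N x| / s^N)^2], so orbits growing slightly faster than [s^n] are
   already bounded by multiples of [s^n], and one descends from [s = |T|] in finitely many steps.
   Hence [T^*] is isometric on [H'_u], which forces [A = 1], that is [T = T'], there.  Finally [H'_u] is the orthogonal
   complement of the vectors [T^n z] with [T^* z = 0], whence the wandering subspace property. *)
Require Import Defs.
From mathcomp Require Import all_boot all_order all_algebra.
From mathcomp Require Import complex reals boolp classical_sets.
From mathcomp Require Import ring lra.
Set Implicit Arguments. Unset Strict Implicit. Unset Printing Implicit Defensive.
Import Order.TTheory GRing.Theory Num.Theory.
Local Open Scope ring_scope.
Import ComplexField.Normc.
Local Notation "x %:C" := (real_complex _ x).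

(** * Inner product geometry: real part, norm, Cauchy-Schwarz, parallelogram law *)

Section Geometry.
Variables (R : realType) (V : lmodType R[i]) (ip : V -> V -> R[i]).
Hypothesis H : is_hilbert ip.
Local Notation hn := (hnorm ip).

(** A real symmetric bilinear form, so that estimates stay in the ordered field [R]; [ip_eq0_re]
    leads back to [ip]. *)
Definition rip (x y : V) : R := complex.Re (ip x y).

Lemma ipDl x y z : ip (x + y) z = ip x z + ip y z.
Proof. by case: H => h _ _ _ _; have := h 1 x y z; rewrite scale1r mul1r. Qed.

Lemma ip0l z : ip 0 z = 0.
Proof. by apply: (addrI (ip 0 z)); rewrite -ipDl !addr0. Qed.

Lemma ipZl a x z : ip (a *: x) z = a * ip x z.
Proof. by case: H => h _ _ _ _; have := h a x 0 z; rewrite ip0l !addr0. Qed.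

Lemma ip_conj x y : ip y x = ((ip x y)^*)%C.
Proof. by case: H => _ h _ _ _; rewrite h. Qed.

Lemma ipDr x y z : ip x (y + z) = ip x y + ip x z.
Proof. by rewrite ip_conj ipDl rmorphD /= -!ip_conj. Qed.

Lemma ip0r x : ip x 0 = 0.
Proof. by rewrite ip_conj ip0l rmorph0. Qed.

Lemma ipZr a x y : ip x (a *: y) = (a^*)%C * ip x y.
Proof. by rewrite ip_conj ipZl rmorphM /= -!ip_conj. Qed.

Lemma ipNl x y : ip (- x) y = - ip x y.
Proof. by rewrite -scaleN1r ipZl mulN1r. Qed.

Lemma ipBl x y z : ip (x - y) z = ip x z - ip y z.
Proof. by rewrite ipDl ipNl. Qed.

Lemma ipBr x y z : ip x (y - z) = ip x y - ip x z.
Proof. by rewrite ip_conj ipBl rmorphB /= -!ip_conj. Qed.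

Lemma ip_eq0 x : ip x x = 0 -> x = 0.
Proof. by case: H => _ _ _ h _; apply: h. Qed.

Lemma ripC x y : rip x y = rip y x.
Proof. by rewrite /rip ip_conj; case: (ip y x). Qed.

Lemma ripDl x y z : rip (x + y) z = rip x z + rip y z.
Proof. by rewrite /rip ipDl raddfD. Qed.

Lemma ripNl x z : rip (- x) z = - rip x z.
Proof. by rewrite /rip ipNl raddfN. Qed.

Lemma ripZl (a : R) x y : rip (a%:C *: x) y = a * rip x y.
Proof. by rewrite /rip ipZl; case: (ip x y) => b c /=; rewrite mul0r subr0. Qed.

Lemma ripDr x y z : rip x (y + z) = rip x y + rip x z.
Proof. by rewrite ripC ripDl !(ripC x). Qed.

Lemma ripNr x z : rip x (- z) = - rip x z.
Proof. by rewrite ripC ripNl ripC. Qed.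

Lemma ripZr (a : R) x y : rip x (a%:C *: y) = a * rip x y.
Proof. by rewrite ripC ripZl ripC. Qed.

Lemma rip_ge0 x : 0 <= rip x x.
Proof. by case: H => _ _ h _ _; case: (h x). Qed.

Lemma ip_self x : ip x x = (rip x x)%:C.
Proof.
case: H => _ _ h _ _; case: (h x) => hI _; rewrite /rip.
by move: hI; case: (ip x x) => a b /= ->.
Qed.

Lemma hnorm_sqr x : hn x ^+ 2 = rip x x.
Proof. by rewrite sqr_sqrtr // rip_ge0. Qed.

Lemma hnorm_ge0 x : 0 <= hn x.
Proof. exact: sqrtr_ge0. Qed.

Lemma hnorm0 : hn 0 = 0.
Proof. by rewrite /hnorm ip0l sqrtr0. Qed.

Lemma hnorm_eq0 x : hn x = 0 -> x = 0.
Proof.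
by move=> h; apply: ip_eq0; rewrite ip_self -hnorm_sqr h expr0n.
Qed.

Lemma hnormN x : hn (- x) = hn x.
Proof. by rewrite /hnorm -!/(rip _ _) ripNl ripNr opprK. Qed.

Lemma hnormBC x y : hn (x - y) = hn (y - x).
Proof. by rewrite -opprB hnormN. Qed.

Lemma hnormZ a x : hn (a *: x) = normc a * hn x.
Proof.
rewrite /hnorm ipZl ipZr ip_self; case: a => a b /=.
rewrite -sqrtrM ?addr_ge0 ?sqr_ge0 //; congr Num.sqrt; ring.
Qed.

Lemma hnorm_sqrD x y : hn (x + y) ^+ 2 = hn x ^+ 2 + 2 * rip x y + hn y ^+ 2.
Proof. rewrite !hnorm_sqr ripDl !ripDr (ripC y x); ring. Qed.

Lemma hnorm_sqrB x y : hn (x - y) ^+ 2 = hn x ^+ 2 - 2 * rip x y + hn y ^+ 2.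
Proof. by rewrite hnorm_sqrD ripNr hnormN mulrN. Qed.

Lemma parallelogram x y :
  hn (x + y) ^+ 2 + hn (x - y) ^+ 2 = 2 * (hn x ^+ 2 + hn y ^+ 2).
Proof. rewrite hnorm_sqrD hnorm_sqrB; ring. Qed.

Lemma cauchy_schwarz x y : rip x y <= hn x * hn y.
Proof.
have [x0|x0] := eqVneq (hn x) 0.
  by rewrite x0 (hnorm_eq0 x0) /rip ip0l mul0r.
have xp : 0 < hn x by rewrite lt_def x0 hnorm_ge0.
have [y0|y0] := eqVneq (hn y) 0.
  by rewrite y0 (hnorm_eq0 y0) /rip ip0r mulr0.
have yp : 0 < hn y by rewrite lt_def y0 hnorm_ge0.
(* The squared norm of [|y| x - |x| y] is [2 |x| |y| (|x| |y| - rip x y)]. *)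
have := sqr_ge0 (hn ((hn y)%:C *: x - (hn x)%:C *: y)).
rewrite hnorm_sqrB !hnorm_sqr !ripZl !ripZr -!hnorm_sqr => h.
have {h} : 0 <= (2 * (hn x * hn y)) * (hn x * hn y - rip x y).
  apply: le_trans h _; rewrite le_eqVlt; apply/orP; left; apply/eqP; ring.
by rewrite pmulr_rge0 ?subr_ge0 // !mulr_gt0.
Qed.

Lemma hnorm_triangle x y : hn (x + y) <= hn x + hn y.
Proof.
rewrite -(@ler_pXn2r _ 2) ?nnegrE ?addr_ge0 ?hnorm_ge0 // hnorm_sqrD.
have := cauchy_schwarz x y; rewrite sqrrD; lra.
Qed.

Lemma hnorm_triangleB x y : hn (x - y) <= hn x + hn y.
Proof. by rewrite -(hnormN y) hnorm_triangle. Qed.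

Lemma hnorm_sub_le x y : hn x - hn y <= hn (x - y).
Proof. by rewrite lerBlDr; have := hnorm_triangle (x - y) y; rewrite subrK. Qed.

End Geometry.

(** Compactness of [[a, b]] in the form of a Lebesgue number, obtained from a supremum instead of
    finite subcovers. *)
Lemma interval_uniform (R : realType) (P : R -> R -> Prop) (a b : R) :
  (forall t, exists2 d, 0 < d & P t d) ->
  (forall t d d', 0 < d' -> d' <= d -> P t d -> P t d') ->
  (forall t t' d, P t d -> `|t' - t| < d / 2 -> P t' (d / 2)) ->
  exists2 d, 0 < d & forall t, a <= t <= b -> P t d.
Proof.
move=> Pex Pmon Ploc.
have [ba|ab] := ltP b a; first by exists 1 => // t; lra.
pose E := [set s | s <= b /\ exists2 d, 0 < d & forall t, a <= t <= s -> P t d]%classic.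
have Ea : E a.
  split=> //; have [d d0 Pd] := Pex a; exists d => // t tE.
  by have -> : t = a by lra.
have ubE : ubound E b by move=> s [].
have hsE : has_sup E by split; [exists a | exists b].
have sb : sup E <= b by apply: ge_sup => //; exists a.
have sa : a <= sup E by apply: ub_le_sup => //; exists b.
have [d d0 Pd] := Pex (sup E).
have d20 : 0 < d / 2 by lra.
have [s [sb' [e e0 Pe]] hs] := sup_adherent d20 hsE.
pose m := Num.min e (d / 2).
have m0 : 0 < m by rewrite /m lt_min e0.
have Pm t : a <= t -> t < sup E + d / 2 -> P t m.
  move=> at_ ts; have [h|h] := leP t s.
    by apply: (Pmon _ e) => //; [rewrite /m ge_min lexx | apply: Pe; lra].
  apply: (Pmon _ (d / 2)) => //; first by rewrite /m ge_min lexx orbT.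
  by apply: Ploc Pd _; rewrite ltr_norml; lra.
have bs : b <= sup E.
  rewrite leNgt; apply/negP => h.
  (* [Pm] reaches all points below [sup E + d / 2], so a smaller step past the supremum would still
     lie in [E]. *)
  pose s' := Num.min b (sup E + d / 4).
  have : s' <= sup E.
    apply: ub_le_sup; first by exists b.
    split; first by rewrite /s' ge_min lexx.
    exists m => // t /andP[at_ ts]; apply: Pm => //.
    by move: ts; rewrite /s' le_min; lra.
  by rewrite /s' ge_min; lra.
by exists m => // t tE; apply: Pm; lra.
Qed.

(** * The real-valued modulus of complex numbers *)

Section Modulus.
Variable R : realType.
Implicit Types z w : R[i].

Lemma normcE z : `|z| = (normc z)%:C.
Proof. by []. Qed.

Lemma normc_ge0 z : 0 <= normc z.
Proof. by case: z => a b; apply: sqrtr_ge0. Qed.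

Lemma normcD z w : normc (z + w) <= normc z + normc w.
Proof. by rewrite -lecR rmorphD /= -!normcE ler_normD. Qed.

Lemma normcX z n : normc (z ^+ n) = normc z ^+ n.
Proof.
elim: n => [|n IH]; last by rewrite !exprS normcM IH.
by rewrite !expr0 normc1.
Qed.

Lemma normcN z : normc (- z) = normc z.
Proof. by apply: complexI; rewrite -!normcE normrN. Qed.

Lemma normcR (a : R) : normc a%:C = `|a|.
Proof. by rewrite /= expr0n addr0 sqrtr_sqr. Qed.

Lemma normc_gt0 z : (0 < normc z) = (z != 0).
Proof. by rewrite -normr_gt0 normcE ltcR. Qed.

Lemma normc_le z (m : R) : normc z <= m -> `|complex.Re z| <= m /\ `|complex.Im z| <= m.
Proof.
case: z => a b /= h; split; apply: le_trans h; rewrite -sqrtr_sqr ler_sqrt ?addr_ge0 ?sqr_ge0 //.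
  by rewrite lerDl sqr_ge0.
by rewrite lerDr sqr_ge0.
Qed.

End Modulus.

(** * Growth of real sequences *)

Section Growth.
Variable R : realType.
Implicit Types (q B K C p : R) (u : nat -> R).

Lemma expr_unbounded q B : 1 < q -> exists n, B < q ^+ n.
Proof.
move=> q1; have q10 : 0 < q - 1 by lra.
have bern n : 1 + n%:R * (q - 1) <= q ^+ n.
  elim: n => [|n IH]; first by rewrite expr0; lra.
  rewrite exprS; apply: le_trans (ler_wpM2l _ IH); last by lra.
  have h : 0 <= n%:R * (q - 1) ^+ 2 by rewrite mulr_ge0 ?sqr_ge0.
  by rewrite -natr1; nra.
have := archi_boundP (normr_ge0 (B / (q - 1))); set n := Num.bound _ => hn.
exists n; apply: lt_le_trans (bern n).
have : B / (q - 1) < n%:R by apply: le_lt_trans hn; rewrite ler_norm.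
by rewrite ltr_pdivrMr //; lra.
Qed.

(* Once the sum [S N] of the first [N] squares exceeds [4 K u_0^2], the hypothesis gives [S N / 4 K <= S (N + 1) - S N],
   so the sums grow faster than [p ^+ (2 * N)]. *)
Lemma sum_sqr_bounded u K p C : 0 < K -> 1 < p -> p ^+ 2 < 1 + (4 * K)^-1 ->
  (forall n, 0 <= u n) -> (forall n, u n <= C * p ^+ n) ->
  (forall N, \sum_(n < N) u n ^+ 2 <= K * (u 0%N + u N) ^+ 2) ->
  forall N, \sum_(n < N) u n ^+ 2 <= 4 * K * u 0%N ^+ 2.
Proof.
move=> K0 p1 pe u0 ub hu N0; rewrite leNgt; apply/negP => big0.
pose S N := \sum_(n < N) u n ^+ 2.
have SS N : S N.+1 = S N + u N ^+ 2 by rewrite /S big_ord_recr.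
have S0 : 0 < S N0 by apply: le_lt_trans big0; rewrite !mulr_ge0 ?sqr_ge0 // ltW.
pose e := (4 * K)^-1.
have e0 : 0 < e by rewrite invr_gt0; lra.
have eK : e * (4 * K) = 1 by rewrite mulVf //; lra.
have term N : 4 * K * u 0%N ^+ 2 < S N -> e * S N <= u N ^+ 2.
  move=> hN; have := hu N; rewrite -/(S N) => h.
  have h2 : (u 0%N + u N) ^+ 2 <= 2 * u 0%N ^+ 2 + 2 * u N ^+ 2.
    by have := sqr_ge0 (u 0%N - u N); nra.
  have h3 : S N <= 4 * K * u N ^+ 2.
    have : K * (u 0%N + u N) ^+ 2 <= K * (2 * u 0%N ^+ 2 + 2 * u N ^+ 2) by rewrite ler_wpM2l // ltW.
    by lra.
  have : e * S N <= e * (4 * K * u N ^+ 2) by rewrite ler_wpM2l // ltW.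
  by rewrite mulrA eK mul1r.
have grow j : 4 * K * u 0%N ^+ 2 < S (N0 + j)%N /\ (1 + e) ^+ j * S N0 <= S (N0 + j)%N.
  elim: j => [|j [IH1 IH2]]; first by rewrite addn0 expr0 mul1r.
  rewrite addnS SS; have h := term _ IH1; split.
    by apply: lt_le_trans IH1 _; rewrite lerDl sqr_ge0.
  have : (1 + e) * ((1 + e) ^+ j * S N0) <= (1 + e) * S (N0 + j)%N.
    by rewrite ler_wpM2l //; lra.
  by rewrite (exprS (1 + e)); move: ((1 + e) ^+ j) => q; lra.
have p20 : 0 < p ^+ 2 by rewrite exprn_gt0 //; lra.
have q1 : 1 < (1 + e) / p ^+ 2 by rewrite ltr_pdivlMr // mul1r.
(* At index [N0 + j], [e (1 + e)^j S N0 <= u^2 <= C^2 p^(2 (N0 + j))] bounds every power of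
   [(1 + e) / p^2 > 1] by this constant. *)
have [j] := expr_unbounded (C ^+ 2 * p ^+ 2 ^+ N0 / (e * S N0)) q1.
rewrite ltNge => /negP; apply.
have [h1 h2] := grow j.
rewrite expr_div_n ler_pdivrMr ?(exprn_gt0 j p20) // mulrAC ler_pdivlMr ?mulr_gt0 //.
have h3 : u (N0 + j)%N ^+ 2 <= (C * p ^+ (N0 + j)) ^+ 2.
  by rewrite ler_pXn2r ?nnegrE ?u0 ?(le_trans (u0 (N0 + j)%N)) //.
have h4 := term _ h1.
have h5 : e * ((1 + e) ^+ j * S N0) <= e * S (N0 + j)%N by rewrite ler_wpM2l // ltW.
have : e * ((1 + e) ^+ j * S N0) <= (C * p ^+ (N0 + j)) ^+ 2 by lra.
rewrite exprMn exprD !(exprAC p 2%N); set a := (1 + e) ^+ j; set b := _ ^+ N0; set d := _ ^+ j; lra.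
Qed.

Lemma invS_small (e : R) : 0 < e ->
  exists N, forall n, (N <= n)%N -> n.+1%:R^-1 < e.
Proof.
move=> e0; have := archi_boundP (normr_ge0 e^-1); set N := Num.bound _ => hN.
exists N => n Nn; rewrite invf_plt ?posrE //.
apply: le_lt_trans (ler_norm _) (lt_le_trans hN _).
by rewrite ler_nat leqW.
Qed.

End Growth.

(** * From the approximate point spectrum to the growth of orbits *)

Section Spectral.
Variables (R : realType) (V : lmodType R[i]) (ip : V -> V -> R[i]).
Hypothesis H : is_hilbert ip.
Local Notation hn := (hnorm ip).

(** Exposes the constant of [bounded_below_shift] and allows any sign, so that perturbing [lam] is
    plain subtraction. *)
Definition lower_bound (T : V -> V) (lam : R[i]) (c : R) : Prop :=
  forall x, c * hn x <= hn (T x - lam *: x).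

Lemma lower_bound_le T lam c d : d <= c -> lower_bound T lam c -> lower_bound T lam d.
Proof.
by move=> dc h x; apply: le_trans (h x); rewrite ler_wpM2r ?hnorm_ge0.
Qed.

Lemma lower_bound_near T lam mu c :
  lower_bound T lam c -> lower_bound T mu (c - normc (mu - lam)).
Proof.
move=> h x; rewrite mulrBl lerBlDr; apply: le_trans (h x) _.
have -> : T x - lam *: x = (T x - mu *: x) + (mu - lam) *: x.
  by rewrite scalerBl addrA subrK.
by rewrite -(hnormZ H) hnorm_triangle.
Qed.

(** Large [lam] are handled by the triangle inequality; the others lie in a square, where local
    bounds become uniform by compactness. *)
Lemma lower_bound_uniform (T : V -> V) (M r : R) :
  (forall x, hn (T x) <= M * hn x) -> sigma_ap_in_circle ip T -> 1 < r ->
  exists2 c, 0 < c & forall lam, r <= normc lam -> lower_bound T lam c.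
Proof.
move=> Mb hsig r1.
pose P lam (d : R) := forall mu, normc (mu - lam) < d -> r <= normc mu -> lower_bound T mu d.
have Pex lam : exists2 d, 0 < d & P lam d.
  (* Around a point of the unit circle the radius [r - 1] makes [P] vacuous: no [mu] that close has
     modulus at least [r]. *)
  have [l1|l1] := eqVneq (normc lam) 1.
    exists (r - 1) => [|mu]; first lra.
    by have := normcD (mu - lam) lam; rewrite subrK l1; lra.
  have [[c [c0 hc]]|/hsig] := pselect (bounded_below_shift ip T lam); last first.
    by rewrite normcE => /complexI h; rewrite h eqxx in l1.
  exists (c / 2) => [|mu h _]; first lra.
  apply: lower_bound_le (lower_bound_near mu hc); lra.
have Pmon lam d d' : 0 < d' -> d' <= d -> P lam d -> P lam d'.
  move=> d0 dd h mu hmu rmu; apply: (lower_bound_le dd); apply: h => //; lra.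
have Ploc lam lam' d : P lam d -> normc (lam' - lam) < d / 2 -> P lam' (d / 2).
  move=> h hl mu hmu rmu; have := normcD (mu - lam') (lam' - lam).
  rewrite addrA subrK => hm.
  apply: (@lower_bound_le _ _ d); last by apply: h => //; lra.
  by have := normc_ge0 (lam' - lam); lra.
pose m := `|M| + 1.
(* Compactness of the square, one coordinate at a time: first the imaginary part, then the real
   part. *)
have Qex a : exists2 d, 0 < d & forall t, - m <= t <= m -> P (Complex a t) d.
  apply: interval_uniform => [t|t|t t' d h ht]; first exact: Pex.
    exact: Pmon.
  apply: Ploc h _; rewrite /= subrr expr0n add0r sqrtr_sqr; exact: ht.
have [d d0 Pd] : exists2 d, 0 < d & forall a, - m <= a <= m ->
    forall t, - m <= t <= m -> P (Complex a t) d.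
  apply: interval_uniform => [a|a d d' d0 dd h t ht|a a' d h ha t ht].
  - exact: Qex.
  - by apply: Pmon (h t ht).
  - by apply: Ploc (h t ht) _; rewrite /= subrr expr0n addr0 sqrtr_sqr.
exists (Num.min d 1) => [|lam rl]; first by rewrite lt_min d0 ltr01.
have [lm|/ltW lm] := leP (normc lam) m.
  have [] := normc_le lm; rewrite !ler_norml => ha hb.
  apply: (@lower_bound_le _ _ d); first by rewrite ge_min lexx.
  case: lam rl lm ha hb => a b rl lm /= ha hb.
  apply: Pd ha _ hb _ _ rl.
  by rewrite subrr normc0.
(* For [|lam| >= |M| + 1], [|lam x| - |T x| >= |x|]; hence the cap at 1. *)
move=> x; rewrite hnormBC //.
apply: le_trans (hnorm_sub_le H _ _); rewrite hnormZ //.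
have h1 := Mb x; have h2 : M * hn x <= `|M| * hn x by rewrite ler_wpM2r ?hnorm_ge0 ?ler_norm.
have h3 : m * hn x <= normc lam * hn x by rewrite ler_wpM2r ?hnorm_ge0.
have h4 : Num.min d 1 * hn x <= 1 * hn x by rewrite ler_wpM2r ?hnorm_ge0 ?ge_min ?lexx ?orbT.
by move: h3; rewrite /m mulrDl; lra.
Qed.

(* Merge the terms of index [n] and [n + 2 ^ k]; the parallelogram law gives the sign of the square root of [z]. *)
Lemma phase_pow2 k (v : nat -> V) (z : R[i]) : normc z = 1 ->
  exists w, [/\ normc w = 1, w ^+ (2 ^ k) = z &
    \sum_(n < 2 ^ k) hn (v n) ^+ 2 <= hn (\sum_(n < 2 ^ k) w ^+ n *: v n) ^+ 2].
Proof.
elim: k v z => [|k IH] v z z1.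
  by exists z; rewrite expn0 !big_ord1 expr0 scale1r expr1.
have [z' [z'1 z'2 hz']] : exists z', [/\ normc z' = 1, z' ^+ 2 = z &
    \sum_(n < 2 ^ k.+1) hn (v n) ^+ 2 <=
    \sum_(n < 2 ^ k) hn (v n + z' *: v (2 ^ k + n)%N) ^+ 2].
  pose y := sqrtc z.
  have y2 : y ^+ 2 = z by rewrite sqr_sqrtc.
  have y1 : normc y = 1.
    by apply/eqP; rewrite -(@eqrXn2 _ 2) ?normc_ge0 // -normcX y2 z1 expr1n.
  have key : \sum_(n < 2 ^ k) hn (v n + y *: v (2 ^ k + n)%N) ^+ 2 +
      \sum_(n < 2 ^ k) hn (v n + (- y) *: v (2 ^ k + n)%N) ^+ 2 =
      2 * \sum_(n < 2 ^ k.+1) hn (v n) ^+ 2.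
    rewrite expnS mul2n -addnn big_split_ord /= -!big_split /= mulr_sumr.
    apply: eq_bigr => n _.
    by rewrite scaleNr parallelogram // hnormZ // y1 mul1r.
  case: (leP (\sum_(n < 2 ^ k.+1) hn (v n) ^+ 2)
     (\sum_(n < 2 ^ k) hn (v n + y *: v (2 ^ k + n)%N) ^+ 2)) => h.
    by exists y.
  exists (- y); split; [by rewrite normcN | by rewrite sqrrN | lra].
(* Prescribing [w ^+ (2 ^ k) = z'] turns the merged sum back into the full sum of the
   [w ^+ n *: v n]. *)
have [w [w1 wz hw]] := IH (fun n => v n + z' *: v (2 ^ k + n)%N) z' z'1.
exists w; split=> //; first by rewrite expnSr exprM wz.
apply: le_trans hz' (le_trans hw _).
rewrite expnS mul2n -addnn big_split_ord /= -big_split /=.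
rewrite le_eqVlt; apply/orP; left; apply/eqP; congr (hn _ ^+ 2).
by apply: eq_bigr => n _; rewrite scalerDr scalerA exprD wz mulrC.
Qed.

(** Replaces integration over the circle, where the mean of the right-hand side is the left-hand
    side. Padding by zeros to [2 ^ N] terms reduces to the dyadic case. *)
Lemma exists_phase N (v : nat -> V) :
  exists2 w, normc w = 1 &
    \sum_(n < N) hn (v n) ^+ 2 <= hn (\sum_(n < N) w ^+ n *: v n) ^+ 2.
Proof.
have [w [w1 _ hw]] := phase_pow2 N (fun n => if (n < N)%N then v n else 0)
  (normc1 R).
exists w => //; apply: le_trans (le_trans hw _).
  rewrite (big_ord_widen _ (fun n => hn (v n) ^+ 2) (ltnW (ltn_expl N (isT : (1 < 2)%N)))).
  rewrite [leRHS](bigID (fun n : 'I__ => (n < N)%N)) /= ler_wpDr //.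
    by apply: sumr_ge0 => n _; apply: sqr_ge0.
  by apply: ler_sum => n ->.
rewrite le_eqVlt; apply/orP; left; apply/eqP; congr (hn _ ^+ 2).
rewrite (big_ord_widen _ (fun n => w ^+ n *: v n) (ltnW (ltn_expl N (isT : (1 < 2)%N)))).
rewrite [RHS]big_mkcond; apply: eq_bigr => n _.
by case: ifP; rewrite ?scaler0.
Qed.

Lemma op0 (T : V -> V) : is_linear T -> T 0 = 0.
Proof.
move=> h; have := h 1 0 0; rewrite !scale1r addr0 => e.
by apply: (addrI (T 0)); rewrite addr0 -e.
Qed.

Lemma opD (T : V -> V) : is_linear T -> forall x y, T (x + y) = T x + T y.
Proof. by move=> h x y; have := h 1 x y; rewrite !scale1r. Qed.

Lemma opZ (T : V -> V) : is_linear T -> forall a x, T (a *: x) = a *: T x.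
Proof. by move=> h a x; have := h a x 0; rewrite (op0 h) !addr0. Qed.

Lemma opB (T : V -> V) : is_linear T -> forall x y, T (x - y) = T x - T y.
Proof. by move=> h x y; rewrite -scaleN1r (opD h) (opZ h) scaleN1r. Qed.

(* With [lam = s / w], apply the lower bound to the partial sum of the geometric series of [T / lam]. *)
Lemma orbit_sum_bound (T : V -> V) (s c : R) : is_linear T -> 0 < s -> 0 < c ->
  (forall lam, normc lam = s -> lower_bound T lam c) ->
  forall x N, \sum_(n < N) (hn (iter n T x) / s ^+ n) ^+ 2 <=
    (s / c) ^+ 2 * (hn x + hn (iter N T x) / s ^+ N) ^+ 2.
Proof.
move=> lin s0 c0 hlb x N.
have hsn n : normc (s^-1 ^+ n)%:C = (s ^+ n)^-1.
  by rewrite normcR exprVn ger0_norm // invr_ge0 exprn_ge0 // ltW.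
have [w w1] := exists_phase N (fun n => (s^-1 ^+ n)%:C *: iter n T x).
under eq_bigr => n _ do rewrite hnormZ // hsn mulrC.
set f := \sum_(n < N) _ *: _ => hw.
apply: le_trans hw _.
pose mu := w * (s^-1)%:C.
have mun : normc mu = s^-1 by rewrite normcM w1 mul1r -[(s^-1)%:C]expr1 -rmorphXn hsn expr1.
have mu0 : mu != 0 by rewrite -normc_gt0 mun invr_gt0.
have fE : f = \sum_(n < N) mu ^+ n *: iter n T x.
  by apply: eq_bigr => n _; rewrite scalerA exprMn rmorphXn.
(* Only the first and last terms survive, and [T - lam = - lam (1 - mu T)] for [lam = mu^-1]. *)
have tel : f - mu *: T f = x - mu ^+ N *: iter N T x.
  rewrite fE; elim: (N) => [|n IH]; first by rewrite !big_ord0 (op0 lin) scaler0 expr0 scale1r !subrr.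
  rewrite !big_ord_recr /= (opD lin) (opZ lin) scalerDr scalerA -exprS opprD addrACA IH.
  by rewrite addrA subrK.
have h := hlb mu^-1 _ f; rewrite normcV mun invrK in h.
have {h} := h erefl.
have -> : T f - mu^-1 *: f = - mu^-1 *: (f - mu *: T f).
  by rewrite scalerBr !scalerA mulNr mulVf // !scaleNr scale1r opprK addrC.
rewrite tel hnormZ // normcN normcV mun invrK => h.
have h2 := hnorm_triangleB H x (mu ^+ N *: iter N T x).
rewrite hnormZ // normcX mun exprVn mulrC in h2.
rewrite -exprMn ler_pXn2r ?nnegrE ?hnorm_ge0 //; last first.
  by rewrite mulr_ge0 ?divr_ge0 ?addr_ge0 ?divr_ge0 ?hnorm_ge0 ?exprn_ge0 // ltW.
rewrite mulrAC ler_pdivlMr // mulrC; apply: le_trans h _.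
by rewrite ler_wpM2l // ltW.
Qed.

(** The rate descends from [M] to [r] by factors [p]. One [p] serves all steps because [K] dominates
    [(s / c)^2] for every [s <= M] that occurs. *)
Lemma power_bound (T : V -> V) (r : R) : bounded_op ip T -> sigma_ap_in_circle ip T ->
  1 < r -> exists C, forall x n, hn (iter n T x) <= C * r ^+ n * hn x.
Proof.
move=> [lin [M0 hM0]] hsig r1.
pose M := Num.max M0 r.
have Mr : r <= M by rewrite le_max lexx orbT.
have hM x : hn (T x) <= M * hn x.
  by apply: le_trans (hM0 x) _; rewrite ler_wpM2r ?hnorm_ge0 // le_max lexx.
have [c c0 hc] := lower_bound_uniform hM hsig r1.
pose K := (M / c) ^+ 2.
have M0' : 0 < M by lra.
have K0 : 0 < K by rewrite exprn_gt0 // divr_gt0.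
pose C := Num.max 1 (4 * K).
have C1 : 1 <= C by rewrite le_max lexx.
pose e := Num.min 1 (4 * K)^-1.
have e0 : 0 < e by rewrite lt_min ltr01 invr_gt0; lra.
have e1 : e <= 1 by rewrite ge_min lexx.
(* As [e <= 1], [p^2 = 1 + 2 e / 3 + e^2 / 9 < 1 + e], as [sum_sqr_bounded] requires. *)
pose p := 1 + e / 3.
have p1 : 1 < p by rewrite /p; lra.
have pe : p ^+ 2 < 1 + (4 * K)^-1.
  apply: (@lt_le_trans _ _ (1 + e)); last by rewrite lerD2l ge_min lexx orbT.
  by rewrite /p; nra.
have p0 : 0 < p by lra.
(* The constants [B] may depend on [x], but the resulting [C] depends neither on [x] nor on [s]. *)
have step s : r <= s -> s <= M ->
    (forall x, exists B, forall n, hn (iter n T x) <= B * (s * p) ^+ n) ->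
    forall x n, hn (iter n T x) <= C * s ^+ n * hn x.
  move=> rs sM hb x n; have s0 : 0 < s by lra.
  have sn k : 0 < s ^+ k by rewrite exprn_gt0.
  pose u k := hn (iter k T x) / s ^+ k.
  have u_ge0 k : 0 <= u k by rewrite divr_ge0 ?hnorm_ge0 // ltW.
  have u_0 : u 0%N = hn x by rewrite /u expr0 divr1.
  have [B hB] := hb x.
  have uB k : u k <= B * p ^+ k.
    by rewrite ler_pdivrMr // -mulrA -exprMn (mulrC p).
  have usum N : \sum_(k < N) u k ^+ 2 <= K * (u 0%N + u N) ^+ 2.
    rewrite u_0; apply: le_trans (orbit_sum_bound lin s0 c0 _ x N) _.
      by move=> lam hl; apply: hc; rewrite hl.
    rewrite ler_wpM2r ?sqr_ge0 // /K ler_pXn2r ?nnegrE ?divr_ge0 //; try lra.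
    by rewrite ler_pM2r // invr_gt0.
  have := sum_sqr_bounded K0 p1 pe u_ge0 uB usum n.+1.
  rewrite big_ord_recr /= => h.
  have h2 : u n ^+ 2 <= (C * u 0%N) ^+ 2.
    have h3 : 0 <= \sum_(k < n) u k ^+ 2 by apply: sumr_ge0 => k _; apply: sqr_ge0.
    have h4 : 4 * K * u 0%N ^+ 2 <= C * C * u 0%N ^+ 2.
      rewrite ler_wpM2r ?sqr_ge0 //; have : 4 * K <= C by rewrite le_max lexx orbT.
      by nra.
    by rewrite (exprMn _ C) (expr2 C); lra.
  have Cu : 0 <= C * u 0%N by rewrite (mulr_ge0 _ (u_ge0 0%N)) //; lra.
  rewrite ler_pXn2r ?nnegrE ?u_ge0 // in h2; move: h2.
  by rewrite u_0 ler_pdivrMr // mulrAC.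
have all_s : forall j x, exists B, forall n,
    hn (iter n T x) <= B * (Num.max r (M / p ^+ j)) ^+ n.
  elim=> [|j IH] x.
    exists (hn x) => n; rewrite expr0 divr1 max_r // mulrC.
    elim: n => [|n IHn]; first by rewrite expr0 mul1r.
    by rewrite /= exprS -mulrA; apply: le_trans (hM _) _; rewrite ler_wpM2l // ltW.
  set s := Num.max r _.
  have rs : r <= s by rewrite le_max lexx.
  have sM : s <= M.
    rewrite ge_max Mr ler_pdivrMr ?exprn_gt0 // ler_pMr //.
    by rewrite exprn_ege1 // ltW.
  exists (C * hn x) => n; rewrite mulrAC; apply: step => // y.
  have [B hB] := IH y.
  exists `|B| => k; apply: le_trans (hB k) _.
  apply: (@le_trans _ _ (`|B| * Num.max r (M / p ^+ j) ^+ k)).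
    by rewrite ler_wpM2r ?ler_norm // exprn_ge0 // le_max; apply/orP; left; lra.
  rewrite ler_wpM2l // lerXn2r ?nnegrE //.
  - by rewrite le_max; apply/orP; left; lra.
  - by rewrite mulr_ge0 //; lra.
  rewrite ge_max; apply/andP; split; first by nra.
  rewrite /s exprS invfM (mulrC p^-1) mulrA.
  have hle : M / p ^+ j / p <= Num.max r (M / p ^+ j / p) by rewrite le_max lexx orbT.
  by rewrite -ler_pdivrMr.
(* Once [p ^+ j] exceeds [M / r], the maximum in [all_s] equals [r]. *)
have [j hj] := expr_unbounded (M / r) p1.
exists C; apply: step => // x; have [B hB] := all_s j x; exists `|B| => n.
apply: le_trans (hB n) _; rewrite max_l; last first.
  rewrite ler_pdivrMr ?exprn_gt0 // mulrC -ler_pdivrMr; first exact: ltW.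
  by lra.
apply: (@le_trans _ _ (`|B| * r ^+ n)).
  by rewrite ler_wpM2r ?ler_norm // exprn_ge0 //; lra.
rewrite ler_wpM2l // lerXn2r ?nnegrE //; nra.
Qed.

End Spectral.

(** * Orthogonal complements, projections and closed spans *)

Section Subspaces.
Variables (R : realType) (V : lmodType R[i]) (ip : V -> V -> R[i]).
Hypothesis H : is_hilbert ip.
Local Notation hn := (hnorm ip).

(** The scalars 1 and [i] recover the real and the imaginary part. *)
Lemma ip_eq0_re x y : (forall a, rip ip (a *: x) y = 0) -> ip x y = 0.
Proof.
move=> h; have := h 1; have := h (Complex 0 1).
rewrite /rip !ipZl //; case: (ip x y) => a b /=.
rewrite !mul0r !mul1r !sub0r subr0 => /eqP; rewrite oppr_eq0 => /eqP -> ->.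
by [].
Qed.

Lemma ip_nondeg x y : (forall z, ip z x = ip z y) -> x = y.
Proof.
move=> h; apply/eqP; rewrite -subr_eq0; apply/eqP; apply: (ip_eq0 H).
by rewrite ipBr // h subrr.
Qed.

Lemma orth_closed_subspace (M : V -> Prop) : closed_subspace ip (orth ip M).
Proof.
split=> [x _|a x y hx hy z Mz|u l hu ul x Mx]; first by rewrite ip0r.
  by rewrite ipDr // ipZr // hx // hy // mulr0 addr0.
apply: ip_eq0_re => a; apply/eqP; rewrite eq_le; apply/andP.
(* One inequality for all scalars suffices, since [b] may be replaced by its negative. *)
have small b : rip ip (b *: x) l <= 0.
  apply/ler_addgt0Pl => e e0; rewrite addr0.
  have e'0 : 0 < e / (hn (b *: x) + 1) by rewrite divr_gt0 // ltr_pwDr // hnorm_ge0.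
  have [n hn_] := ul _ e'0.
  have := cauchy_schwarz H (b *: x) (l - u n).
  rewrite ripDr // ripNr // {2}/rip (ipZl H) (hu n x Mx) mulr0 subr0 => h.
  apply: le_trans h _; rewrite (hnormBC H); have := hn_ n (leqnn n).
  rewrite ltr_pdivlMr ?ltr_pwDr ?hnorm_ge0 //.
  by have := hnorm_ge0 ip (b *: x); have := hnorm_ge0 ip (u n - l); nra.
split; first exact: small.
by have := small (- a); rewrite scaleNr ripNl // oppr_le0.
Qed.

(** A minimizing sequence for the distance from [x] to [M] is Cauchy, and its limit is the
    projection. *)
Lemma projection_exists (M : V -> Prop) x : closed_subspace ip M ->
  exists2 m, M m & orth ip M (x - m).
Proof.
move=> [M0 Mlin Mlim].
have MD y z : M y -> M z -> M (y + z) by move=> hy hz; rewrite -(scale1r y); apply: Mlin.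
have MZ a y : M y -> M (a *: y) by move=> hy; rewrite -[_ *: _]addr0; apply: Mlin.
pose E := [set r | exists2 m, M m & r = hn (x - m)]%classic.
have Elb : lbound E 0 by move=> _ [m _ ->]; apply: hnorm_ge0.
have Ei : has_inf E by split; [exists (hn (x - 0)); exists 0 | exists 0].
pose d := inf E.
have dE m : M m -> d <= hn (x - m).
  by move=> Mm; apply: ge_inf; [exists 0 | exists m].
have d0 : 0 <= d by apply: lb_le_inf Elb; case: Ei.
have [u hu] : {u : nat -> V & forall n, M (u n) /\ hn (x - u n) < d + n.+1%:R^-1}.
  apply: (@choice _ _ (fun n m => M m /\ hn (x - m) < d + n.+1%:R^-1)) => n.
  have e0 : (0 : R) < n.+1%:R^-1 by rewrite invr_gt0.
  by have [_ [m Mm ->] h] := inf_adherent e0 Ei; exists m.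
(* Parallelogram law: the midpoint of [y] and [z] is at distance at least [d], which leaves
   [4 (d + e)^2 - 4 d^2]. *)
have near_min y z e : 0 < e -> M y -> M z -> hn (x - y) < d + e -> hn (x - z) < d + e ->
    hn (y - z) ^+ 2 <= 8 * d * e + 4 * e ^+ 2.
  move=> e0 My Mz hy hz.
  have := parallelogram H (x - y) (x - z).
  have -> : (x - y) - (x - z) = z - y by rewrite opprB [LHS]addrC addrA subrK.
  have -> : (x - y) + (x - z) = (2 : R)%:C *: (x - (2^-1 : R)%:C *: (y + z)).
    rewrite scalerBr scalerA -rmorphM divff ?pnatr_eq0 // rmorph1 scale1r rmorph_nat.
    by rewrite scaler_nat mulr2n addrACA opprD.
  rewrite hnormZ // normcR ger0_norm // (hnormBC H z).
  have := dE _ (MZ (2^-1 : R)%:C _ (MD _ _ My Mz)).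
  set w := hn (x - _ *: _) => dw.
  have := hnorm_ge0 ip (x - y); have := hnorm_ge0 ip (x - z).
  move: (hn (x - y)) (hn (x - z)) hy hz => a b ha hb b0 a0; rewrite exprMn => h.
  have : d ^+ 2 <= w ^+ 2 by rewrite ler_pXn2r ?nnegrE // (le_trans d0).
  have : a ^+ 2 <= (d + e) ^+ 2 by rewrite ler_pXn2r ?nnegrE //; lra.
  have : b ^+ 2 <= (d + e) ^+ 2 by rewrite ler_pXn2r ?nnegrE //; lra.
  by rewrite !sqrrD; lra.
have [l hl] : exists l, converges_to ip u l.
  case: H => _ _ _ _; apply=> e e0.
  (* With [e1 <= 1] the bound of [near_min] is at most [(8 d + 4) e1]; the 5 makes it strictly less
     than [e^2]. *)
  pose e1 := Num.min 1 (e ^+ 2 / (8 * d + 5)).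
  have d50 : 0 < 8 * d + 5 by lra.
  have e10 : 0 < e1 by rewrite lt_min ltr01 divr_gt0 // exprn_gt0.
  have e11 : e1 <= 1 by rewrite ge_min lexx.
  have e12 : e1 * (8 * d + 5) <= e ^+ 2 by rewrite -ler_pdivlMr // ge_min lexx orbT.
  clearbody e1; have [N hN] := invS_small e10; exists N => m n Nm Nn.
  have [Mm hm] := hu m; have [Mn hn'] := hu n.
  have := near_min _ _ _ e10 Mm Mn (lt_le_trans hm _) (lt_le_trans hn' _).
  rewrite !lerD2l !(ltW (hN _ _)) // => /(_ isT isT) h.
  rewrite -(@ltr_pXn2r _ 2) ?nnegrE ?hnorm_ge0 // ?ltW //.
  apply: le_lt_trans h _; apply: lt_le_trans e12.
  have : e1 ^+ 2 <= e1 * 1 by rewrite expr2 ler_wpM2l // ltW.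
  by lra.
have Ml : M l by apply: Mlim hl => n; case: (hu n).
have hd : hn (x - l) <= d.
  apply/ler_addgt0Pl => e e0; have e20 : 0 < e / 2 by lra.
  have [N1 h1] := invS_small e20; have [N2 h2] := hl _ e20.
  pose n := maxn N1 N2.
  have {}h1 := h1 n (leq_maxl _ _); have {}h2 := h2 n (leq_maxr _ _).
  have := hnorm_triangle H (x - u n) (u n - l); rewrite addrA subrK.
  by have [_] := hu n; move: (n.+1%:R^-1) h1 => q; lra.
exists l => // y My; apply: ip_eq0_re => a; rewrite ripC //.
set z := a *: y; have Mz : M z by apply: MZ.
set r := rip _ _ _.
have [z0|z0] := eqVneq (hn z) 0.
  by rewrite /r (hnorm_eq0 H z0) /rip ip0r.
(* Moving [l] by the best real multiple of [z] lowers the squared distance by [r^2 / |z|^2], so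
   minimality forces [r = 0]. *)
pose t := r / hn z ^+ 2.
have := dE _ (MD _ _ Ml (MZ t%:C _ Mz)); rewrite opprD addrA => h.
have h2 : hn (x - l) ^+ 2 <= hn (x - l - t%:C *: z) ^+ 2.
  by rewrite ler_pXn2r ?nnegrE ?hnorm_ge0 // (le_trans hd).
move: h2; rewrite (hnorm_sqrB H (x - l)) ripZr // -/r (hnormZ H) normcR exprMn real_normK ?num_real //.
have tz : t * hn z ^+ 2 = r by rewrite mulfVK // expf_neq0.
have -> : t ^+ 2 * hn z ^+ 2 = t * r by rewrite expr2 -mulrA tz.
have -> : t * r = r ^+ 2 / hn z ^+ 2 by rewrite /t mulrAC -expr2.
rewrite -addrA lerDl => h2.
have : 0 <= - (r ^+ 2 / hn z ^+ 2) by lra.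
rewrite oppr_ge0 pmulr_lle0 ?invr_gt0 ?exprn_gt0 ?lt_def ?z0 ?hnorm_ge0 // => h3.
by apply/eqP; rewrite -sqrf_eq0 eq_le h3 sqr_ge0.
Qed.

Lemma lin_span_incl (E : V -> Prop) y : E y -> lin_span E y.
Proof.
move=> Ey; exists [:: (1, y)]; split; last by rewrite big_seq1 scale1r.
by move=> p; rewrite inE => /eqP ->.
Qed.

Lemma lin_span_lin (E : V -> Prop) a x y :
  lin_span E x -> lin_span E y -> lin_span E (a *: x + y).
Proof.
move=> [s [hs ->]] [t [ht ->]].
exists ([seq (a * p.1, p.2) | p <- s] ++ t); split.
  move=> p; rewrite mem_cat => /orP[/mapP[q qs ->]|]; [exact: hs qs | exact: ht].
rewrite big_cat big_map scaler_sumr; congr (_ + _).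
by apply: eq_bigr => p _; rewrite scalerA.
Qed.

Lemma closed_span_incl (E : V -> Prop) y : E y -> closed_span ip E y.
Proof.
by move=> Ey e e0; exists y; [exact: lin_span_incl | rewrite subrr (hnorm0 H)].
Qed.

Lemma closed_span_closed (E : V -> Prop) : closed_subspace ip (closed_span ip E).
Proof.
split=> [e e0|a x y hx hy e e0|u l hu ul e e0].
- exists 0; last by rewrite subrr (hnorm0 H).
  by exists [::]; split; rewrite ?big_nil.
- have a0 := normc_ge0 a.
  have e1 : 0 < e / (2 * (normc a + 1)) by rewrite divr_gt0 //; lra.
  have e2 : 0 < e / 2 by lra.
  have [x' sx' hx'] := hx _ e1; have [y' sy' hy'] := hy _ e2.
  exists (a *: x' + y'); first exact: lin_span_lin.
  rewrite opprD addrACA -scalerBr; apply: le_lt_trans (hnorm_triangle H _ _) _.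
  rewrite hnormZ //; move: hx'; rewrite ltr_pdivlMr; last by lra.
  by have := hnorm_ge0 ip (x - x'); nra.
- have e2 : 0 < e / 2 by lra.
  have [n hn_] := ul _ e2; have {}hn_ := hn_ n (leqnn n).
  have [y sy hy] := hu n _ e2; exists y => //.
  have := hnorm_triangle H (l - u n) (u n - y); rewrite addrA subrK (hnormBC H l (u n)).
  lra.
Qed.

Lemma closed_span_min (E M : V -> Prop) : closed_subspace ip M ->
  (forall y, E y -> M y) -> forall x, closed_span ip E x -> M x.
Proof.
move=> [M0 Mlin Mlim] EM x hx.
have spanM y : lin_span E y -> M y.
  move=> [s [hs ->]]; elim: s hs => [|p s IH] hs; first by rewrite big_nil.
  rewrite big_cons; apply: Mlin; first by apply/EM/hs; rewrite inE eqxx.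
  by apply: IH => q qs; apply: hs; rewrite inE qs orbT.
have [u hu] : {u : nat -> V & forall n, lin_span E (u n) /\ hn (x - u n) < n.+1%:R^-1}.
  apply: (@choice _ _ (fun n m => lin_span E m /\ hn (x - m) < n.+1%:R^-1)) => n.
  have e0 : (0 : R) < n.+1%:R^-1 by rewrite invr_gt0.
  by have [y sy hy] := hx _ e0; exists y.
apply: (Mlim u) => [n|e e0]; first by apply: spanM; case: (hu n).
have [N hN] := invS_small e0; exists N => n Nn.
by rewrite (hnormBC H); have [_ h] := hu n; apply: lt_trans h (hN n Nn).
Qed.

End Subspaces.

(** * The Cauchy dual of a weakly concave operator and its range core *)

Section WeaklyConcave.
Variables (R : realType) (V : lmodType R[i]) (ip : V -> V -> R[i]) (T Ts A : V -> V).
Hypotheses (H : is_hilbert ip) (adj : is_adjoint ip T Ts).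
Hypothesis TTA : forall x, Ts (T (A x)) = x.
Hypothesis wc : weakly_concave ip T Ts A.
Local Notation hn := (hnorm ip).
Local Notation Td := (cauchy_dual T A).
Local Notation core := (range_core Td).

Let boundedT : bounded_op ip T. Proof. by case: wc => -[]. Qed.

Lemma adj_sym x y : ip (Ts x) y = ip x (T y).
Proof. by rewrite (ip_conj H y) -adj -(ip_conj H). Qed.

Lemma adj_linear : is_linear Ts.
Proof.
move=> a x y; apply: (ip_nondeg H) => z.
by rewrite -adj !ipDr // !ipZr // -!adj.
Qed.

Lemma cauchy_dualK x : Ts (Td x) = x.
Proof. exact: TTA. Qed.

Lemma inverse_sym x y : ip (A x) y = ip x (A y).
Proof. by rewrite -{1}(TTA y) -adj -adj_sym TTA. Qed.

Lemma rip_adj x y : rip ip (T x) y = rip ip x (Ts y).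
Proof. by rewrite /rip adj. Qed.

Lemma hnorm_sqr_dual x : hn (Td x) ^+ 2 = rip ip (A x) x.
Proof. by rewrite (hnorm_sqr H) rip_adj TTA. Qed.

(** [|Td x|^2 = rip (A x) x <= |A x| |x|], and expansivity gives [|A x| <= |T (A x)| = |Td x|]. *)
Lemma hnorm_dual_le x : hn (Td x) <= hn x.
Proof.
have [_ _ expT _] := wc.
have h : hn (Td x) * hn (Td x) <= hn (Td x) * hn x.
  rewrite -expr2 hnorm_sqr_dual; apply: le_trans (cauchy_schwarz H _ _) _.
  by rewrite ler_wpM2r ?hnorm_ge0 // expT.
have [d0|d0] := eqVneq (hn (Td x)) 0; first by rewrite d0 hnorm_ge0.
by rewrite -(@ler_pM2l _ (hn (Td x))) // lt_def d0 hnorm_ge0.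
Qed.

(* The third condition says that [Td] is hyponormal for the inner product [<A x, y>], whose norm is [hn (Td x)];
   hyponormality makes the norms along an orbit log-convex. *)
Lemma dual_log_convex x :
  hn (Td (Td x)) ^+ 2 <= hn (Td (Td (Td x))) * hn (Td x).
Proof.
have [_ _ _ hypo] := wc.
(* [Td Ts] is the orthogonal projection onto the range of [T], which contains [Td x]. The third
   condition at [A (Td x)] then replaces [Ts] by [T]. *)
have -> : hn (Td (Td x)) ^+ 2 = rip ip (Td (Ts (A (Td x)))) (Td x).
  have e w : ip (Td (Ts w)) (Td x) = ip w (Td x).
    by rewrite /cauchy_dual adj TTA inverse_sym adj_sym.
  by rewrite hnorm_sqr_dual /rip e.
by apply: le_trans (cauchy_schwarz H _ _) _; rewrite ler_wpM2r ?hnorm_ge0 // hypo.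
Qed.

Lemma iter_dualK n x : iter n Ts (iter n Td x) = x.
Proof.
elim: n x => [//|n IH] x; by rewrite iterSr iterS cauchy_dualK IH.
Qed.

(** Powers of [Ts] are left inverses of those of [Td], so the preimage of [y] can only be
    [iter n Ts y]. *)
Lemma coreP y : core y <-> forall n, y = iter n Td (iter n Ts y).
Proof.
split=> [h n|h n]; last by exists (iter n Ts y).
by have [x ->] := h n; rewrite iter_dualK.
Qed.

Lemma core_adj y : core y -> core (Ts y).
Proof. by move=> h n; have [x ->] := h n.+1; exists x; rewrite iterS cauchy_dualK. Qed.

Lemma core_dual y : core y -> core (Td y).
Proof. by move=> h [|n]; [exists (Td y) | have [x ->] := h n; exists x]. Qed.

Lemma core_dual_adj y : core y -> Td (Ts y) = y.
Proof. by move=> /coreP /(_ 1%N). Qed.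

Lemma core_adj_iter n y : core y -> core (iter n Ts y).
Proof. by move=> h; elim: n => //= n; apply: core_adj. Qed.

Lemma adj_iter n x y : ip (iter n T x) y = ip x (iter n Ts y).
Proof. by elim: n x => // n IH x; rewrite iterSr IH adj. Qed.

(** The constant for [T] is kept: for [z = iter n Ts y], [|z|^2 = rip (iter n T z) y], and one
    factor [|z|] cancels. *)
Lemma adj_power_bound r : 1 < r -> exists C, forall y n, hn (iter n Ts y) <= C * r ^+ n * hn y.
Proof.
move=> r1; have [_ hs _ _] := wc; have [C hC] := power_bound H boundedT hs r1.
exists C => y n; set z := iter n Ts y.
have [z0|z0] := eqVneq (hn z) 0.
  rewrite z0; have := hC y n; exact: le_trans (hnorm_ge0 _ _).
have zp : 0 < hn z by rewrite lt_def z0 hnorm_ge0.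
rewrite -(ler_pM2r zp) -expr2 (hnorm_sqr H) /rip -adj_iter mulrAC.
by apply: le_trans (cauchy_schwarz H _ _) _; rewrite ler_wpM2r ?hnorm_ge0.
Qed.

(* A strict increase would propagate by log-convexity to exponential growth of [Ts^n y], which the spectral
   condition excludes. *)
Lemma core_adj_isometry y : core y -> hn (Ts y) = hn y.
Proof.
move=> cy; apply/eqP; rewrite eq_le andbC -{1}(core_dual_adj cy) hnorm_dual_le /= leNgt.
apply/negP => lt01.
pose c n := hn (iter n Ts y).
have logc n : c n.+1 ^+ 2 <= c n * c n.+2.
  (* On the core [Td] undoes [Ts], so read backwards the orbit of [y] is an orbit of [Td];
     [dual_log_convex] is used at [Ts z]. *)
  pose z := iter n.+2 Ts y; have cz : core z by apply: core_adj_iter.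
  have e1 : iter n.+1 Ts y = Td z by exact: esym (core_dual_adj (core_adj_iter n.+1 cy)).
  have e0 : iter n Ts y = Td (Td z) by rewrite -e1; exact: esym (core_dual_adj (core_adj_iter n cy)).
  rewrite /c e1 e0 -/z -(core_dual_adj cz); exact: dual_log_convex.
have c0 : 0 < c 0%N.
  rewrite lt_def hnorm_ge0 andbT; apply/eqP => h; move: lt01.
  have -> : y = 0 := hnorm_eq0 H h.
  by rewrite (op0 adj_linear) ltxx.
pose rho := c 1%N / c 0%N.
have rho1 : 1 < rho by rewrite ltr_pdivlMr // mul1r.
have incr n : 0 < c n /\ rho * c n <= c n.+1.
  elim: n => [|n [cp le]]; first by rewrite mulfVK ?gt_eqF.
  have cp1 : 0 < c n.+1 by apply: lt_le_trans le; rewrite mulr_gt0 //; lra.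
  split=> //; rewrite -(ler_pM2l cp); apply: le_trans (logc n).
  by rewrite expr2 mulrCA mulrA ler_wpM2r // ltW.
have grow n : rho ^+ n * c 0%N <= c n.
  elim: n => [|n IH]; first by rewrite expr0 mul1r.
  rewrite exprS -mulrA; apply: le_trans (incr n).2.
  by rewrite ler_wpM2l //; lra.
(* Any rate strictly between 1 and [rho] contradicts growth like [rho ^+ n]. *)
pose r := (1 + rho) / 2.
have r1 : 1 < r by rewrite /r; lra.
have r0 : 0 < r by lra.
have [C hC] := adj_power_bound r1.
have q1 : 1 < rho / r by rewrite ltr_pdivlMr // mul1r /r; lra.
have [n] := expr_unbounded C q1; rewrite ltNge => /negP; apply.
rewrite expr_div_n ler_pdivrMr ?exprn_gt0 // -(ler_pM2r c0).
exact: le_trans (grow n) (hC y n).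
Qed.

(** Equality case of [hnorm_dual_le]: [rip (A z) z = |z|^2] and [|A z| <= |z|] give
    [|A z - z|^2 <= 0]. *)
Lemma core_inverse_fix z : core z -> A z = z.
Proof.
move=> cz; have iso : hn (Td z) = hn z.
  by rewrite -(core_adj_isometry (core_dual cz)) cauchy_dualK.
have [_ _ expT _] := wc.
apply/eqP; rewrite -subr_eq0; apply/eqP; apply: (hnorm_eq0 H).
apply/eqP; rewrite -sqrf_eq0 eq_le sqr_ge0 andbT (hnorm_sqrB H) -hnorm_sqr_dual iso.
have : hn (A z) ^+ 2 <= hn z ^+ 2.
  by rewrite ler_pXn2r ?nnegrE ?hnorm_ge0 // -iso expT.
lra.
Qed.

Lemma core_dualE z : core z -> Td z = T z.
Proof. by move=> cz; rewrite /cauchy_dual core_inverse_fix. Qed.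

(** For [w = iter n Ts y], the defect [w - Td (Ts w)] lies in the kernel of [Ts]. Orthogonality of
    [y] to its image under [iter n T] makes it vanish, which lengthens the factorization of [y] by
    one [Td]. *)
Lemma core_orthE y : core y <-> orth ip (fun v => exists n z, Ts z = 0 /\ v = iter n T z) y.
Proof.
split=> [cy _ [n [z [z0 ->]]]|h].
  rewrite adj_iter -(core_dual_adj (core_adj_iter n cy)).
  by rewrite /cauchy_dual -adj_sym z0 ip0l.
apply/coreP; elim=> [//|n IH]; rewrite iterSr /= [LHS]IH; congr iter.
set w := iter n Ts y; apply/eqP; rewrite -subr_eq0; apply/eqP.
have k0 : Ts (w - Td (Ts w)) = 0 by rewrite (opB adj_linear) cauchy_dualK subrr.
apply: (ip_eq0 H); rewrite {1}ipBr // -adj_iter h; last by exists n, (w - Td (Ts w)).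
by rewrite /cauchy_dual -adj_sym k0 ip0l // subrr.
Qed.

Lemma core_closed : closed_subspace ip core.
Proof.
have [h0 hl hc] := orth_closed_subspace H (fun v => exists n z, Ts z = 0 /\ v = iter n T z).
split; first exact/core_orthE.
  by move=> a x y /core_orthE hx /core_orthE hy; apply/core_orthE/hl.
by move=> u l hu ul; apply/core_orthE/(hc u) => // n; apply/core_orthE.
Qed.

(** The core is stable under [T], which equals [Td] there, and under [Ts], which gives stability of
    the complement. *)
Lemma core_reduces : reduces ip T core.
Proof.
split; [exact: core_closed | by move=> x cx; rewrite -core_dualE //; apply: core_dual|].
by move=> x ox m cm; rewrite -adj_sym; apply/ox/core_adj.
Qed.

Lemma core_unitary : unitary_on ip T core.
Proof.
split=> [x cx|y cy].
  by rewrite -core_dualE // -(core_adj_isometry (core_dual cx)) cauchy_dualK.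
exists (Ts y); first exact: core_adj.
by rewrite -core_dualE ?core_dual_adj //; apply: core_adj.
Qed.

Lemma core_sub_range_core y : core y -> range_core T y.
Proof.
move=> cy n; exists (iter n Ts y); elim: n => // n IH.
rewrite [iter n.+1 Ts y]/= iterSr -core_dualE ?core_dual_adj //.
  exact: core_adj_iter.
exact/core_adj/core_adj_iter.
Qed.

(** The remainder after projecting onto the closed span is orthogonal to all [iter n T z] with
    [Ts z = 0], hence in the core; it is also in the complement of the core, so it is zero. *)
Lemma core_orth_wandering : wandering_subspace_property ip T (orth ip core).
Proof.
have [_ _ Tinv] := core_reduces.
set G := (fun y => exists n z, ker_restr_adj ip T (orth ip core) z /\ y = iter n T z).
have GK : forall x, closed_span ip G x -> orth ip core x.
  apply: closed_span_min => //; first exact: orth_closed_subspace.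
  by move=> _ [n [z [[Kz _] ->]]]; elim: n => //= n; apply: Tinv.
move=> x; split=> [Kx|]; last exact: GK.
have [m Gm om] := projection_exists H x (closed_span_closed H G).
have cxm : core (x - m).
  apply/core_orthE => _ [n [z [z0 ->]]]; apply/om/closed_span_incl => //.
  (* The kernel of [Ts] lies in the complement of the core, because each core vector [y = Td (Ts y)]
     is in the range of [T]. *)
  exists n, z; split=> //; split=> [y cy|y _]; last by rewrite adj z0 ip0r.
  by rewrite -(core_dual_adj cy) /cauchy_dual adj z0 ip0r.
suff -> : x = m by [].
apply/eqP; rewrite -subr_eq0; apply/eqP; apply: (ip_eq0 H).
by rewrite {2}/GRing.add /= ipBr // Kx // (GK _ Gm) // subrr.
Qed.

End WeaklyConcave.

Theorem theorem1p2 (R : realType) (V : lmodType R[i]) (ip : V -> V -> R[i])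
    (T Ts A : V -> V) :
  is_hilbert ip ->
  is_adjoint ip T Ts ->
  (forall x, A (Ts (T x)) = x) -> (forall x, Ts (T (A x)) = x) ->
  weakly_concave ip T Ts A ->
  let Hu := range_core T in
  let Hu' := range_core (cauchy_dual T A) in
  [/\ (forall x, Hu' x -> Hu x),
      reduces ip T Hu',
      unitary_on ip T Hu'
    & wandering_subspace_property ip T (orth ip Hu')].
Proof.
move=> H adj _ TTA wc Hu Hu'; split.
- by move=> x; apply: (core_sub_range_core H adj TTA wc).
- exact: (core_reduces H adj TTA wc).
- exact: (core_unitary H adj TTA wc).
- exact: (core_orth_wandering H adj TTA wc).
Qed.
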